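(* Suppose there is no small cell in the studied area, so that a user at polar position $(r,\theta)$ is served by the central macrocell with SINR $\gamma(r,\theta)=1/g(r)$ and throughput $\eta(r,\theta)=\min\big(K_1W\ln(1+K_2\gamma(r,\theta)),\eta_0\big)$. Let the user location be distributed on the disk $S^*$ of radius $R$ centered at the origin according to the normalized measure $\frac1S\,dt(r,\theta)$, where $dt$ is the Gaussian hotspot measure centered at $(R_h,\theta_h)$ with standard deviation $A$, and $S=\int_{S^*}dt(r,\theta)$. Then for every $0<l\le\eta_0$, $$\mathbb{P}(\eta\ge l)=\frac1S\,\frac{e^{-\frac{R_h^2}{2A^2}}}{A^2}\int_0^{\Lambda} r\,e^{-\frac{r^2}{2A^2}}\,I_0\!\left(\frac{rR_h}{A^2}\right)dr,$$ where $\Lambda=\min\big(g^{-1}(\psi(l)),R\big)$, $\psi(l)=K_2\big(e^{\frac{l}{K_1W}}-1\big)^{-1}$, and $I_0$ is the modified Bessel function of the first kind of order $0$.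
   Context: Constants: inter-site distance $\delta>0$; cell radius $R$ with $0<R<\delta$; pathloss parameter $b>1$ (pathloss exponent $2b$); macrocell transmit power $P>0$; noise power $P_N\ge 0$; average interfering-cell load $\alpha\in(0,1]$; $K_1,K_2,W,\eta_0>0$; hotspot parameters $A>0$, $0\le R_h<R$, $\theta_h\in[0,2\pi)$. The hotspot measure, in polar coordinates, is $$dt(r,\theta)=\frac{1}{2\pi A^2}e^{-\frac{|re^{i\theta}-R_he^{i\theta_h}|^2}{2A^2}}\,r\,dr\,d\theta .$$ The interference-plus-noise factor is, for $0\le r<\delta$, $$g(r)=6\alpha\left(\frac r\delta\right)^{2b}\left(\frac{1+(1-b)^2(r/\delta)^2}{(1-(r/\delta)^2)^{2b-1}}+\omega(b)-1\right)+\frac{P_N}{P}r^{2b},\qquad \omega(b)=3^{-b}\zeta(b)\left(\zeta(b,\tfrac13)-\zeta(b,\tfrac23)\right),$$ with $\zeta(\cdot)$ the Riemann zeta function and $\zeta(b,q)=\sum_{n\ge0}(n+q)^{-b}$ the Hurwitz zeta function. The function $g$ is continuous and increasing with $g(0)=0$. For $x\ge0$, $\min(g^{-1}(x),R)$ denotes $\sup\{r\in[0,R]: g(r)\le x\}$; thus it equals $R$ when $x\ge g(R)$. $\mathbb{P}(\eta\ge l)$ means $\frac1S\int_{S^*}\mathbb{1}(\eta(r,\theta)\ge l)\,dt(r,\theta)$, where $\mathbb 1(\cdot)$ is the indicator function. (At the null set where $g(r)=0$, $\gamma=+\infty$ and $\eta=\eta_0$.) *)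

(* Defs.v *)
From HB Require Import structures.
From mathcomp Require Import all_boot all_order all_algebra.
From mathcomp Require Import all_classical all_reals all_analysis.
From mathcomp Require Import measurable_realfun.

Set Implicit Arguments.
Unset Strict Implicit.
Unset Printing Implicit Defensive.

Import Order.TTheory GRing.Theory Num.Theory.
Import numFieldNormedType.Exports.

Local Open Scope classical_set_scope.
Local Open Scope ring_scope.

Section special_functions.
Context {R : realType}.
Implicit Types b q x : R.

Definition riemann_zeta b : R :=
  limn (series (fun n : nat => n.+1%:R `^ (- b))).

Definition hurwitz_zeta b q : R :=
  limn (series (fun n : nat => (n%:R + q) `^ (- b))).

(* modified Bessel function of the first kind of order 0, by its power series *)
Definition bessel_I0 x : R :=
  limn (series (fun k : nat => (x / 2) ^+ (2 * k) / (k`!%:R) ^+ 2)).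

Definition omega b : R :=
  3 `^ (- b) * riemann_zeta b
    * (hurwitz_zeta b (1 / 3) - hurwitz_zeta b (2 / 3)).

End special_functions.

Section network.
Context {R : realType}.

(* interference-plus-noise factor; only meaningful for 0 <= r < delta *)
Definition gfactor (delta b P PN alpha : R) (r : R) : R :=
  6 * alpha * (r / delta) `^ (2 * b)
    * ((1 + (1 - b) ^+ 2 * (r / delta) ^+ 2)
         / (1 - (r / delta) ^+ 2) `^ (2 * b - 1) + omega b - 1)
  + PN / P * r `^ (2 * b).

(* extended real: the inverse of 0 is +oo, so the SINR is infinite where g = 0 *)
Definition sinr (g : R -> R) (p : R * R) : \bar R := ((g p.1)%:E^-1)%E.

Definition throughput (K1 K2 W eta0 : R) (g : R -> R) (p : R * R) : \bar R :=
  mine ((K1 * W)%:E * lne (1 + K2%:E * sinr g p))%E eta0%:E.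

(* min(g^-1(x), Rc), read as a supremum so that it makes sense for every x >= 0 *)
Definition min_ginv (g : R -> R) (Rc x : R) : R :=
  sup [set r | 0 <= r <= Rc /\ g r <= x].

Definition psi (K1 K2 W l : R) : R := K2 * (expR (l / (K1 * W)) - 1)^-1.

End network.

(* points of the plane are represented by their polar coordinates (r, theta) *)
Section hotspot.
Context {R : realType}.
Local Notation leb := (@lebesgue_measure R).

Definition polar_domain : set (R * R) := `[0, +oo[ `*` `[0, 2 * pi[.

Definition polar_disk (Rc : R) : set (R * R) := `[0, Rc] `*` `[0, 2 * pi[.

Definition polar_dist2 (p q : R * R) : R :=
  (p.1 * cos p.2 - q.1 * cos q.2) ^+ 2 + (p.1 * sin p.2 - q.1 * sin q.2) ^+ 2.

(* density of dt with respect to dr dtheta, Jacobian r included *)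
Definition hotspot_density (A Rh thetah : R) (p : R * R) : R :=
  1 / (2 * pi * A ^+ 2)
    * expR (- (polar_dist2 p (Rh, thetah) / (2 * A ^+ 2))) * p.1.

Definition hotspot_measure (A Rh thetah : R) (E : set (R * R)) : \bar R :=
  (\int[leb \x leb]_(p in E `&` polar_domain)
     (hotspot_density A Rh thetah p)%:E)%E.

Lemma measurable_polar_domain : measurable polar_domain.
Proof. by apply: measurableX; exact: measurable_itv. Qed.

Lemma measurable_hotspot_density A Rh thetah :
  measurable_fun setT (hotspot_density A Rh thetah).
Proof.
have m1 : measurable_fun setT (fun p : R * R => p.1) by exact: measurable_fst.
have m2 : measurable_fun setT (fun p : R * R => p.2) by exact: measurable_snd.
have mc : measurable_fun setT (fun p : R * R => cos p.2).
  apply: measurableT_comp => //.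
  by apply: continuous_measurable_fun; exact: continuous_cos.
have ms : measurable_fun setT (fun p : R * R => sin p.2).
  apply: measurableT_comp => //.
  by apply: continuous_measurable_fun; exact: continuous_sin.
apply: measurable_funM => //; apply: measurable_funM => //.
apply: measurableT_comp => //; apply: measurableT_comp => //.
apply: measurable_funM => //; apply: measurable_funD.
  apply: measurable_funX; apply: measurable_funB => //.
  exact: measurable_funM.
apply: measurable_funX; apply: measurable_funB => //.
exact: measurable_funM.
Qed.

Lemma hotspot_density_ge0 A Rh thetah p :
  polar_domain p -> 0 <= hotspot_density A Rh thetah p.
Proof.
move=> [/=]; rewrite in_itv/= andbT => p0 _.
rewrite /hotspot_density !mulr_ge0 ?expR_ge0// invr_ge0 mulr_ge0 ?sqr_ge0//.
by rewrite mulr_ge0// pi_ge0.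
Qed.

Section hotspot_instance.
Variables A Rh thetah : R.
Local Notation dt := (hotspot_measure A Rh thetah).

Let dt0 : dt set0 = 0%E.
Proof. by rewrite /hotspot_measure set0I integral_set0. Qed.

Let dt_ge0 E : (0 <= dt E)%E.
Proof.
apply: integral_ge0 => p [_ Dp]; rewrite lee_fin.
exact: hotspot_density_ge0.
Qed.

Let dt_sigma_additive : semi_sigma_additive dt.
Proof.
move=> F mF tF mUF; rewrite /hotspot_measure setI_bigcupl.
rewrite ge0_integral_bigcup//=.
- apply: is_cvg_ereal_nneg_natsum_cond => n _ _; exact: dt_ge0.
- by move=> k; exact: measurableI (mF k) measurable_polar_domain.
- apply: measurable_funTS; apply/measurable_EFinP.
  exact: measurable_hotspot_density.
- by move=> p [n _ [_ Dp]]; rewrite lee_fin; exact: hotspot_density_ge0.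
- exact: trivIset_setIr.
Qed.

HB.instance Definition _ := isMeasure.Build _ _ _ dt
  dt0 dt_ge0 dt_sigma_additive.

End hotspot_instance.

End hotspot.

(* Main.v *)
(* The throughput is at least l exactly where g <= psi(l); as g is nondecreasing
   on [0, Rc] (because omega(b) >= 0), this sublevel set is [0, Lambda] or
   [0, Lambda[, and the two differ by a null set.  Tonelli's theorem in polar
   coordinates and the law of cosines then leave the angular integral of
   exp(z cos(t - s)) over a period.  It equals 2 pi I0(z): integrate the
   exponential series term by term (dominated convergence), the moments of cos
   being given by the Wallis recursion. *)
Require Import Defs.
From HB Require Import structures.
From mathcomp Require Import all_boot all_order all_algebra.
From mathcomp Require Import all_classical all_reals all_analysis.
From mathcomp Require Import measurable_realfun ring lra.

Set Implicit Arguments.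
Unset Strict Implicit.
Unset Printing Implicit Defensive.

Import Order.TTheory GRing.Theory Num.Theory.
Import numFieldNormedType.Exports.

Local Open Scope classical_set_scope.
Local Open Scope ring_scope.

(** * Monotonicity of the interference factor *)

Section interference_factor.
Context {R : realType}.
Implicit Types b q x : R.

(* The discrete integral test: the right-hand side telescopes in x, so this
   bounds the partial sums of the Hurwitz series. *)
Lemma powRN_le_telescope b x : 1 < b -> 0 < x ->
  (b - 1) * (x + 1) `^ (- b) <= x `^ (1 - b) - (x + 1) `^ (1 - b).
Proof.
move=> b1 x0; have y0 : 0 < x + 1 by lra.
(* With [(x + 1) ^ (1 - b)] factored out, the claim is (b - 1) / (x + 1) <= u^(1 - b) - 1 for u = x
   / (x + 1). It follows from exp y >= 1 + y at y = (1 - b) ln u, and from ln u <= u - 1. *)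
have -> : x `^ (1 - b) = (x / (x + 1)) `^ (1 - b) * (x + 1) `^ (1 - b).
  by rewrite -powRM ?divfK ?gt_eqF// ?divr_ge0// ltW.
have -> : (x + 1) `^ (- b) = (x + 1)^-1 * (x + 1) `^ (1 - b).
  rewrite powRD ?(gt_eqF y0) ?implybT// powRr1 ?(ltW y0)//.
  by rewrite mulrA mulVf ?gt_eqF// mul1r.
rewrite mulrA -[X in _ <= _ - X]mul1r -mulrBl ler_wpM2r ?powR_ge0//.
rewrite /powR gt_eqF ?divr_gt0// lerBrDl.
apply: le_trans (expR_ge1Dx _); rewrite lerD2l.
have : ln (x / (x + 1)) <= x / (x + 1) - 1.
  have := @le_ln1Dx R (x / (x + 1) - 1).
  rewrite [1 + _]addrC subrK; apply.
  by have := divr_gt0 x0 y0; lra.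
have -> : x / (x + 1) - 1 = - (x + 1)^-1 by field; rewrite gt_eqF.
nra.
Qed.

Lemma is_cvg_hurwitz_zeta b q : 1 < b -> 0 < q ->
  cvgn (series (fun n : nat => (n%:R + q) `^ (- b))).
Proof.
move=> b1 q0; apply: nondecreasing_is_cvgn.
  by apply: nondecreasing_series => n _ _; exact: powR_ge0.
exists (q `^ (- b) + (b - 1)^-1 * q `^ (1 - b)) => _ [n _ <-].
have c0 : 0 < b - 1 by lra.
case: n => [|n].
  by rewrite /series/= big_geq// addr_ge0 ?mulr_ge0 ?powR_ge0// invr_ge0 ltW.
(* The subtracted power is kept so that the induction telescopes. The term q^(-b) stands apart
   because the telescoping bound at [x = n + q] only controls the terms from index 1 on. *)
suff : series (fun n : nat => (n%:R + q) `^ (- b)) n.+1 <=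
    q `^ (- b) + (b - 1)^-1 * (q `^ (1 - b) - (n%:R + q) `^ (1 - b)).
  move/le_trans; apply; rewrite lerD2l ler_wpM2l ?invr_ge0 ?(ltW c0)//.
  by rewrite gerBl powR_ge0.
elim: n => [|n ih].
  by rewrite /series/= big_nat1 add0r subrr mulr0 addr0.
rewrite /series/= big_nat_recr//=; move: ih; rewrite /series/= => ih.
apply: (le_trans (lerD ih (lexx _))).
rewrite -addrA lerD2l -[X in _ + X](@mulKf _ (b - 1)) ?gt_eqF// -mulrDr.
rewrite ler_wpM2l ?invr_ge0 ?(ltW c0)//.
have /(powRN_le_telescope b1) : 0 < n%:R + q by rewrite ltr_wpDl.
by rewrite -natr1 addrAC; lra.
Qed.

(** Each term (n + q)^(-b) decreases in q, so the Hurwitz value at 1/3 dominates the one at 2/3. *)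
Lemma omega_ge0 b : 1 < b -> 0 <= omega b.
Proof.
move=> b1; rewrite /omega mulr_ge0//.
  rewrite mulr_ge0 ?powR_ge0// /riemann_zeta.
  apply: limr_ge.
    (* The Riemann series is the Hurwitz series at q = 1. *)
    under eq_fun do rewrite -natr1.
    exact: is_cvg_hurwitz_zeta.
  by apply: nearW => n; rewrite sumr_ge0// => i _; exact: powR_ge0.
have q1 : 0 < 1 / 3 :> R by lra.
have q2 : 0 < 2 / 3 :> R by lra.
rewrite subr_ge0; apply: ler_lim; try exact: is_cvg_hurwitz_zeta.
apply: nearW => n; apply: ler_sum => i _.
have i0 : 0 <= i%:R :> R by [].
rewrite !powRN lef_pV2 ?posrE ?powR_gt0//; try lra.
by apply: ge0_ler_powR; rewrite ?nnegrE; lra.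
Qed.

(** The first summand is a product of two nondecreasing factors, which is monotone once both are
    nonnegative. For the bracket this uses [omega b >= 0]. *)
Lemma gfactor_nondecreasing delta b P PN alpha Rc :
  0 < delta -> Rc < delta -> 1 < b -> 0 < P -> 0 <= PN -> 0 < alpha ->
  {in `[0, Rc] &, nondecreasing (gfactor delta b P PN alpha)}.
Proof.
move=> d0 Rd b1 P0 PN0 a0 r s; rewrite !in_itv/= => /andP[r0 rR] /andP[s0 sR] rs.
have pow_le p : 0 <= p ->
    {in Num.nneg &, forall x y, x <= y -> x `^ p <= y `^ p}.
  by move=> p0; exact: ge0_ler_powR.
have x0 : 0 <= r / delta by rewrite divr_ge0// ltW.
have xy : r / delta <= s / delta by rewrite ler_pM2r ?invr_gt0.
have y0 : 0 <= s / delta by apply: le_trans xy.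
have y1 : s / delta < 1 by rewrite ltr_pdivrMr ?mul1r//; lra.
have xy2 : (r / delta) ^+ 2 <= (s / delta) ^+ 2 by rewrite lerXn2r ?nnegrE.
have y21 : (s / delta) ^+ 2 < 1 by rewrite expr_lt1.
have x20 : 0 <= (r / delta) ^+ 2 by exact: sqr_ge0.
have c0 := sqr_ge0 (1 - b).
have w0 := omega_ge0 b1.
rewrite /gfactor.
set x2 := (r / delta) ^+ 2 in xy2 x20 *; set y2 := (s / delta) ^+ 2 in xy2 y21 *.
set c := (1 - b) ^+ 2 in c0 *.
have dx0 : 0 < (1 - x2) `^ (2 * b - 1) by apply: powR_gt0; lra.
have dy0 : 0 < (1 - y2) `^ (2 * b - 1) by apply: powR_gt0; lra.
have dyx : (1 - y2) `^ (2 * b - 1) <= (1 - x2) `^ (2 * b - 1).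
  by apply: pow_le; rewrite ?nnegrE; lra.
have dx1 : (1 - x2) `^ (2 * b - 1) <= 1.
  have e1 : 1 `^ (2 * b - 1) = 1 :> R by rewrite powR1.
  rewrite -[leRHS]e1.
  by apply: pow_le; rewrite ?nnegrE; lra.
have nx1 : 1 <= 1 + c * x2 by rewrite lerDl mulr_ge0.
have nxy : 1 + c * x2 <= 1 + c * y2 by rewrite lerD2l ler_wpM2l.
(* The fraction absorbs the [- 1] of the bracket. *)
have fx1 : 1 <= (1 + c * x2) / (1 - x2) `^ (2 * b - 1).
  by rewrite ler_pdivlMr// mul1r; lra.
have fxy : (1 + c * x2) / (1 - x2) `^ (2 * b - 1) <=
    (1 + c * y2) / (1 - y2) `^ (2 * b - 1).
  apply: ler_pM => //; [lra|by rewrite invr_ge0 ltW|].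
  by rewrite lef_pV2.
apply: lerD; last first.
  apply: ler_wpM2l; first by rewrite divr_ge0// ltW.
  by apply: pow_le; rewrite ?nnegrE//; lra.
apply: ler_pM.
- by rewrite mulr_ge0 ?powR_ge0// mulr_ge0// ltW.
- lra.
- apply: ler_wpM2l; first by rewrite mulr_ge0// ltW.
  by apply: pow_le; rewrite ?nnegrE//; lra.
- lra.
Qed.

End interference_factor.

(** * Integral representation of I0 over a period *)

Section bessel_integral.
Context {R : realType}.
Local Notation leb := (@lebesgue_measure R).
Implicit Types z s t : R.

(** Antiderivative of cos(t - s)^n in [t], by the Wallis reduction formula; the recursion descends
    two steps at a time. *)
Fixpoint cosX_primitive s n t : R :=
  match n with
  | 0 => t
  | 1 => sin (t - s)
  | (m.+1 as m1).+1 =>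
      (m1%:R * cosX_primitive s m t + cos (t - s) ^+ m1 * sin (t - s))
        / m1.+1%:R
  end.

Lemma is_derive_cosX_primitive s n t :
  is_derive t 1 (cosX_primitive s n) (cos (t - s) ^+ n).
Proof.
have dshift : is_derive t 1 (fun u : R => u - s) 1.
  by apply: is_derive_eq; rewrite subr0.
have dsin : is_derive t 1 (fun u => sin (u - s)) (cos (t - s)).
  by apply: is_derive_eq; rewrite mulr1.
have dcos : is_derive t 1 (fun u => cos (u - s)) (- sin (t - s)).
  by apply: is_derive_eq; rewrite mulr1.
(* Two consecutive exponents are carried through the induction, to match the two-step recursion. *)
suff : is_derive t 1 (cosX_primitive s n) (cos (t - s) ^+ n) /\
  is_derive t 1 (cosX_primitive s n.+1) (cos (t - s) ^+ n.+1) by case.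
elim: n => [|n [ih0 ih1]].
  by split; [exact: is_derive_id|rewrite expr1].
split => //.
have dX := @is_deriveX _ _ (fun u : R => cos (u - s)) n.+1 t 1 _ dcos.
have dM := @is_deriveM _ _ _ _ t 1 _ _ dX dsin.
have dD := @is_deriveD _ _ _ _ _ t 1 _ _
  (@is_deriveZ _ _ _ _ n.+1%:R t 1 _ ih0) dM.
have dZ := @is_deriveZ _ _ _ _ (n.+2%:R^-1) t 1 _ dD.
have -> : cosX_primitive s n.+2 = n.+2%:R^-1 \*:
    (n.+1%:R \*: cosX_primitive s n +
     (fun u => cos (u - s)) ^+ n.+1 * (fun u => sin (u - s))).
  by apply/funext => u /=; rewrite mulrC exprfctE.
apply: (is_derive_eq dZ); rewrite exprfctE /GRing.scale/=.
have := cos2Dsin2 (t - s); set c := cos _; set d := sin _ => cd.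
have n2 : n.+2%:R != 0 :> R by rewrite pnatr_eq0.
apply: (mulfI n2); rewrite mulVKf// !exprSr.
have -> : c ^+ n * c * c = c ^+ n * (1 - d ^+ 2) by rewrite -cd; ring.
ring.
Qed.

(** The boundary term cos^(n+1) sin takes the same value at both ends of a period and cancels,
    leaving the Wallis ratio. *)
Lemma cosX_primitive_period s n :
  cosX_primitive s n.+2 (2 * pi) - cosX_primitive s n.+2 0 =
  n.+1%:R / n.+2%:R * (cosX_primitive s n (2 * pi) - cosX_primitive s n 0).
Proof.
have e : 2 * pi - s = 0 - s + pi *+ 2 :> R by rewrite mulr_natl addrC sub0r.
rewrite /= e cosD2pi sinD2pi.
by field.
Qed.

(** The ratios (2k + 1) / (2k + 2), multiplied up from 2 pi at k = 0, give 2 pi times the central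
    binomial coefficient over 4^k. *)
Lemma cosX_primitive_even s k :
  cosX_primitive s (2 * k) (2 * pi) - cosX_primitive s (2 * k) 0 =
  2 * pi * ((2 * k)`!%:R / (2 ^+ (2 * k) * k`!%:R ^+ 2)).
Proof.
elim: k => [|k ih]; first by rewrite muln0/= fact0 expr0 expr1n; field.
rewrite mulnS cosX_primitive_period ih !factS !natrM !exprS.
have -> : (2 * k).+2%:R = 2 * (k.+1%:R) :> R by rewrite -natrM mulnS.
rewrite exprMn.
field.
by rewrite nat1r !pnatr_eq0 -lt0n fact_gt0 expf_neq0.
Qed.

Lemma cosX_primitive_odd s k :
  cosX_primitive s (2 * k).+1 (2 * pi) - cosX_primitive s (2 * k).+1 0 = 0.
Proof.
elim: k => [|k ih]; last by rewrite mulnS cosX_primitive_period ih mulr0.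
rewrite muln0/=.
have -> : 2 * pi - s = 0 - s + pi *+ 2 :> R by rewrite mulr_natl addrC sub0r.
by rewrite sinD2pi subrr.
Qed.

Lemma continuous_mul_cos z s : continuous (fun t : R => z * cos (t - s)).
Proof.
move=> t; apply: cvgMl_tmp.
apply: (@continuous_comp _ _ _ (fun t : R => t - s) cos).
  by apply: cvgB; [exact: cvg_id|exact: cvg_cst].
exact: continuous_cos.
Qed.

Lemma continuous_expR_mul_cos z s :
  continuous (fun t : R => expR (z * cos (t - s))).
Proof.
move=> t; apply: (@continuous_comp _ _ _ (fun t => z * cos (t - s)) expR).
  exact: continuous_mul_cos.
exact: continuous_expR.
Qed.

Lemma continuous_exp_partial_sum n :
  continuous (fun x : R => series (exp_coeff x) n).
Proof.
move=> x; elim: n => [|n ih].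
  by rewrite [X in continuous_at _ X](_ : _ = cst 0);
    [exact: cvg_cst|apply/funext => y; rewrite /series/= big_geq].
rewrite [X in continuous_at _ X](_ : _ = fun y =>
    series (exp_coeff y) n + y ^+ n / n`!%:R).
  by apply: cvgD ih _; apply: cvgMr_tmp; exact: exprn_continuous.
by apply/funext => y; rewrite /series/= big_nat_recr.
Qed.

Lemma integral_exp_partial_sum z s n :
  (\int[leb]_(t in `[0%R, (2 * pi)%R]) (series (exp_coeff (z * cos (t - s))) n)%:E =
  (series (fun i => z ^+ i / i`!%:R *
     (cosX_primitive s i (2 * pi) - cosX_primitive s i 0)) n)%R%:E)%E.
Proof.
(* By linearity an antiderivative of the partial sum, to which the fundamental theorem applies. *)
pose F := \sum_(i < n) ((z ^+ i / i`!%:R) \*: cosX_primitive s i).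
have dF t : is_derive t 1 F (series (exp_coeff (z * cos (t - s))) n).
  rewrite /series/= big_mkord.
  have dS := is_derive_sum (fun i : 'I_n => @is_deriveZ _ _ _ _
    (z ^+ i / i`!%:R) t 1 _ (is_derive_cosX_primitive s i t)).
  apply: (is_derive_eq dS).
  by apply: eq_bigr => i _; rewrite /exp_coeff/= exprMn /GRing.scale/= mulrAC.
have cF t : {for t, continuous F}.
  by apply/differentiable_continuous/derivable1_diffP; case: (dF t).
rewrite (@continuous_FTC2 _ _ F).
- rewrite -EFinB; congr EFin; rewrite /F !fct_sumE -sumrB seriesEnat/= big_mkord.
  by apply: eq_bigr => i _; rewrite /GRing.scale/= mulrBr.
- by rewrite mulr_gt0 ?pi_gt0.
- apply: continuous_subspaceT => t.
  apply: (@continuous_comp _ _ _ (fun t => z * cos (t - s))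
    (fun x => series (exp_coeff x) n)); last exact: continuous_exp_partial_sum.
  exact: continuous_mul_cos.
- split.
  + by move=> t _; case: (dF t).
  + exact/cvg_at_right_filter/cF.
  + exact/cvg_at_left_filter/cF.
- by move=> t _; rewrite derive1E; case: (dF t).
Qed.

(** A bound uniform in [n], which supplies the dominating function below. *)
Lemma exp_partial_sum_le z n :
  `|series (exp_coeff z) n| <= expR `|z|.
Proof.
apply: (@le_trans _ _ (series (exp_coeff `|z|) n)).
  rewrite /series/=; apply: le_trans (ler_norm_sum _ _ _) _.
  by apply: ler_sum => i _; rewrite /exp_coeff/= normrM normrX normfV normr_nat.
apply: nondecreasing_cvgn_le; last exact: is_cvg_series_exp_coeff.
by apply: nondecreasing_series => i _ _; exact: exp_coeff_ge0.
Qed.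

Lemma cvg_integral_exp_partial_sum z s :
  (\int[leb]_(t in `[0%R, (2 * pi)%R])
     (series (exp_coeff (z * cos (t - s))) n)%:E @[n --> \oo] -->
   \int[leb]_(t in `[0%R, (2 * pi)%R]) (expR (z * cos (t - s)))%:E)%E.
Proof.
have [] // := @dominated_convergence _ _ _ leb `[0, 2 * pi]%classic
  (measurable_itv _)
  (fun n t => (series (exp_coeff (z * cos (t - s))) n)%:E)
  (fun t => (expR (z * cos (t - s)))%:E) (cst (expR `|z|)%:E).
- move=> n; apply: measurable_funTS; apply/measurable_EFinP.
  apply: continuous_measurable_fun.
  move=> t; apply: (@continuous_comp _ _ _ (fun t => z * cos (t - s))
    (fun x => series (exp_coeff x) n)); last exact: continuous_exp_partial_sum.
  exact: continuous_mul_cos.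
- apply: measurable_funTS; apply/measurable_EFinP.
  by apply: continuous_measurable_fun; exact: continuous_expR_mul_cos.
- apply: aeW => t _; apply: cvg_EFin; first exact: nearW.
  exact: is_cvg_series_exp_coeff.
- apply: (@continuous_compact_integrable _ (cst (expR `|z|))).
    exact: segment_compact.
  by apply: continuous_subspaceT => t; exact: cvg_cst.
(* As |cos| <= 1, the constant exp |z| dominates every partial sum. *)
- apply: aeW => t n _; rewrite abse_EFin lee_fin.
  apply: le_trans (exp_partial_sum_le _ _) _; rewrite ler_expR normrM.
  by rewrite ler_piMr// cos_max.
Qed.

(** Only even moments survive, and z^(2k) / (2k)! times the moment of order 2k is 2 pi (z/2)^(2k) /
    k!^2, the k-th term of 2 pi I0(z). *)
Lemma integral_expR_cos z s :
  (\int[leb]_(t in `[0%R, (2 * pi)%R[) (expR (z * cos (t - s)))%:E =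
   (2 * pi * bessel_I0 z)%:E)%E.
Proof.
rewrite integral_itv_bndo_bndc; last first.
  apply: measurable_funTS; apply/measurable_EFinP.
  by apply: continuous_measurable_fun; exact: continuous_expR_mul_cos.
(* Restricting to the partial sums of even length 2k makes them coincide exactly with 2 pi times the
   partial sums of length k of the Bessel series. *)
have := cvg_comp _ _ (@cvg_mulnl 2 isT) (@cvg_integral_exp_partial_sum z s).
set l := (\int[leb]_(t in _) _)%E.
have fl : l \is a fin_num.
  apply: integrable_fin_num => //.
  apply: (@continuous_compact_integrable _ (fun t => expR (z * cos (t - s)))).
    exact: segment_compact.
  by apply: continuous_subspaceT; exact: continuous_expR_mul_cos.
rewrite -(fineK fl) [X in X @ _ --> _ -> _](_ : _ = fun k =>
    (2 * pi * series (fun i => (z / 2) ^+ (2 * i) / i`!%:R ^+ 2) k)%:E).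
  move=> /fine_cvg/(@cvgMl_tmp _ _ _ _ _ (2 * pi)^-1).
  have pi2 : 2 * pi != 0 :> R by rewrite mulf_neq0 ?gt_eqF ?pi_gt0.
  under eq_fun do rewrite /= mulKf//.
  move=> /cvg_lim lE.
  by rewrite /bessel_I0 lE// mulVKf.
apply/funext => k /=; rewrite integral_exp_partial_sum.
congr EFin; elim: k => [|k ih].
  have series0 (u : R ^nat) : series u 0 = 0 by rewrite seriesEnat/= big_geq.
  by rewrite muln0 !series0 mulr0.
(* Two exponential terms are added: index 2k matches the k-th Bessel term, and index 2k + 1
   contributes 0. *)
rewrite (_ : 2 * k.+1 = (2 * k).+2)%N ?mulnS// 2!seriesSr ih.
rewrite cosX_primitive_odd mulr0 addr0 cosX_primitive_even seriesSr.
rewrite expr_div_n; field.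
by rewrite !pnatr_eq0 -!lt0n !fact_gt0 expf_neq0.
Qed.

End bessel_integral.

(** * The coverage event as a sublevel set, and integration in polar coordinates *)

Section coverage.
Context {R : realType}.
Local Notation leb := (@lebesgue_measure R).

(** As [l <= eta0], the logarithmic rate alone decides, and solving K1 W ln(1 + K2 / g) >= l for g
    gives the threshold psi(l). *)
Lemma throughput_ge (K1 K2 W eta0 l : R) (g : R -> R) (p : R * R) :
  0 < K1 -> 0 < K2 -> 0 < W -> 0 < l -> l <= eta0 -> 0 <= g p.1 ->
  (l%:E <= throughput K1 K2 W eta0 g p)%E = (g p.1 <= psi K1 K2 W l).
Proof.
move=> K1_gt0 K2_gt0 W_gt0 l_gt0 l_le g_ge0.
have KW : 0 < K1 * W by rewrite mulr_gt0.
have e0 : 0 < expR (l / (K1 * W)) - 1.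
  by rewrite subr_gt0 expR_gt1 divr_gt0.
rewrite /throughput /sinr /psi le_min [X in _ && X]lee_fin l_le andbT.
move: g_ge0; rewrite le_eqVlt => /predU1P[<-|g_gt0].
  (* Where g = 0 the rate is [+oo] and psi(l) >= 0, so both sides are true. *)
  rewrite inve0 gt0_muley ?lte_fin// addey// /lne/= gt0_muley ?lte_fin// leey.
  by rewrite mulr_ge0 ?invr_ge0 ?ltW.
have q0 : 0 < 1 + K2 / g p.1 by rewrite addr_gt0// divr_gt0.
rewrite inver gt_eqF// -EFinM -EFinD lne_EFin// -EFinM lee_fin.
rewrite mulrC -ler_pdivrMr// -[X in X = _]ler_expR lnK// [1 + _]addrC -lerBlDr.
by rewrite !ler_pdivlMr// mulrC.
Qed.

(** By monotonicity the sublevel set is downward closed in [0, Rc], hence an interval from 0 to its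
    supremum. The boolean tells whether the supremum belongs to it: [false] gives a closed right
    end, [true] an open one. *)
Lemma sublevel_min_ginv (g : R -> R) (Rc x : R) : 0 <= Rc ->
  {in `[0, Rc] &, nondecreasing g} -> g 0 <= x ->
  exists b, [set r | 0 <= r <= Rc /\ g r <= x] =
    [set` Interval (BLeft 0) (BSide b (min_ginv g Rc x))].
Proof.
move=> Rc0 gnd g0x; rewrite /min_ginv; set I := [set r | _].
have I0 : I 0 by split; rewrite ?lexx.
have supI : has_sup I.
  by split; [exists 0|exists Rc => r [/andP[]]].
have le_sup r : I r -> r <= sup I by move=> Ir; exact: sup_ubound supI.2 _ Ir.
have supR : sup I <= Rc by apply: sup_le_ub => [|r [/andP[]]//]; exists 0.
have sup0 : 0 <= sup I by exact: le_sup.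
have lt_sup r : 0 <= r -> r < sup I -> I r.
  move=> r0 /(sup_gt (ex_intro _ 0 I0))[s [/andP[s0 sR] gs] rs].
  split; first by rewrite r0 (le_trans (ltW rs)).
  apply: le_trans gs; apply: gnd (ltW rs); rewrite in_itv/= ?r0 ?s0 ?sR//.
  exact: le_trans (ltW rs) sR.
have [gs|gs] := leP (g (sup I)) x.
  exists false; apply/seteqP; split=> r /=; rewrite in_itv/=.
    by move=> Ir; rewrite le_sup// andbT; case: Ir => /andP[].
  move=> /andP[r0]; rewrite le_eqVlt => /predU1P[->|]; last exact: lt_sup.
  by split; rewrite ?sup0.
exists true; apply/seteqP; split=> r /=; rewrite in_itv/=.
  move=> Ir; rewrite lt_neqAle le_sup// andbT; case: (Ir) => /andP[-> _] gr/=.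
  by apply: contraTneq gs => <-; rewrite -leNgt.
by move=> /andP[]; exact: lt_sup.
Qed.

(** Read off from the integral representation, whose integrand is positive. *)
Lemma bessel_I0_ge0 (z : R) : 0 <= bessel_I0 z.
Proof.
have : (0 <= (2 * pi * bessel_I0 z)%R%:E)%E.
  rewrite -(integral_expR_cos z 0).
  by apply: integral_ge0 => t _; rewrite lee_fin expR_ge0.
by rewrite lee_fin pmulr_rge0// mulr_gt0 ?pi_gt0.
Qed.

(** By the integral representation, 2 pi I0 is a partial integral of a nonnegative measurable
    function of two variables, so Tonelli's theorem makes it measurable. *)
Lemma measurable_bessel_I0 : measurable_fun setT (@bessel_I0 R).
Proof.
pose D : set (R * R) := setT `*` `[0, 2 * pi[.
have mD : measurable D by apply: measurableX => //; exact: measurable_itv.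
pose f := (fun p : R * R => (expR (p.1 * cos (p.2 - 0)))%:E) \_ D.
have mf : measurable_fun setT f.
  apply/(measurable_restrictT _ mD)/measurable_funTS/measurable_EFinP.
  apply: measurableT_comp => //; apply: measurable_funM => //.
  apply: measurableT_comp.
    by apply: continuous_measurable_fun; exact: continuous_cos.
  by apply: measurable_funB.
have f0 p : (0 <= f p)%E.
  by apply: erestrict_ge0 => q _; rewrite lee_fin expR_ge0.
have := @measurable_fun_fubini_tonelli_F _ _ _ _ _ leb _ mf f0.
have -> : fubini_F leb f = EFin \o (fun z => 2 * pi * bessel_I0 z).
  apply/funext => z; rewrite /fubini_F /= -(integral_expR_cos z 0).
  rewrite [RHS]integral_mkcond; apply: eq_integral => t _.
  by rewrite /f !patchE /D in_setX/= in_setT.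
move=> /measurable_EFinP m.
have -> : @bessel_I0 R = fun z => (2 * pi)^-1 * (2 * pi * bessel_I0 z).
  by apply/funext => z; rewrite mulKf// mulf_neq0 ?gt_eqF ?pi_gt0.
exact: measurable_funM.
Qed.

(** The law of cosines splits the exponent, isolating the angle [t] in the last factor. *)
Lemma hotspot_densityE (A Rh s r t : R) : A != 0 ->
  hotspot_density A Rh s (r, t) =
  r * (1 / (2 * pi * A ^+ 2) * expR (- (Rh ^+ 2 / (2 * A ^+ 2)))
    * expR (- (r ^+ 2 / (2 * A ^+ 2)))) * expR (r * Rh / A ^+ 2 * cos (t - s)).
Proof.
move=> A0; rewrite /hotspot_density /= -[in RHS]mulrA -[X in r * X]mulrA.
rewrite -[X in r * X]mulrA -!expRD mulrC; congr (_ * (_ * expR _)).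
rewrite /polar_dist2/= cosB.
have -> : (r * cos t - Rh * cos s) ^+ 2 + (r * sin t - Rh * sin s) ^+ 2 =
  r ^+ 2 * (cos t ^+ 2 + sin t ^+ 2) + Rh ^+ 2 * (cos s ^+ 2 + sin s ^+ 2)
  - 2 * r * Rh * (cos t * cos s + sin t * sin s) by ring.
rewrite !cos2Dsin2; field.
by [].
Qed.

Lemma integral_hotspot_density (A Rh s r : R) : A != 0 -> 0 <= r ->
  (\int[leb]_(t in `[0%R, (2 * pi)%R[) (hotspot_density A Rh s (r, t))%:E =
   (expR (- (Rh ^+ 2 / (2 * A ^+ 2))) / A ^+ 2 *
     (r * expR (- (r ^+ 2 / (2 * A ^+ 2))) * bessel_I0 (r * Rh / A ^+ 2)))%:E)%E.
Proof.
move=> A0 r0; under eq_integral do rewrite hotspot_densityE// EFinM.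
rewrite ge0_integralZl_EFin//=.
- rewrite integral_expR_cos -EFinM; congr EFin.
  move: (pi_gt0 R); move: (@pi R) => q q0; field.
  by rewrite A0 gt_eqF.
- apply: measurable_funTS; apply/measurable_EFinP.
  apply: measurableT_comp => //; apply: measurable_funM => //.
  apply: measurableT_comp.
    by apply: continuous_measurable_fun; exact: continuous_cos.
  by apply: measurable_funB.
- rewrite !mulr_ge0 ?expR_ge0// invr_ge0 mulr_ge0 ?sqr_ge0//.
  by rewrite mulr_ge0 ?pi_ge0.
Qed.

(** The sector is a rectangle in polar coordinates, so Tonelli's theorem applies with the angle
    integrated first. Both kinds of right end are covered, since the sublevel set may have
    either. *)
Lemma hotspot_measure_sector (A Rh s L : R) (b : bool) : A != 0 ->
  (hotspot_measure A Rh s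
     ([set` Interval (BLeft 0%R) (BSide b L)] `*` `[0%R, (2 * pi)%R[) =
   (expR (- (Rh ^+ 2 / (2 * A ^+ 2))) / A ^+ 2)%:E *
   \int[leb]_(r in `[0%R, L])
     (r * expR (- (r ^+ 2 / (2 * A ^+ 2))) * bessel_I0 (r * Rh / A ^+ 2))%:E)%E.
Proof.
move=> A0; set i := Interval _ _; set c := expR _ / _.
pose f (r : R) :=
  r * expR (- (r ^+ 2 / (2 * A ^+ 2))) * bessel_I0 (r * Rh / A ^+ 2).
pose D : set (R * R) := [set` i] `*` `[0, 2 * pi[.
have mD : measurable D by apply: measurableX; exact: measurable_itv.
have Dpolar : D `<=` polar_domain.
  move=> p [/=]; rewrite in_itv/= => /andP[p1 _] p2; split => //=.
  by rewrite in_itv/= p1.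
have mf : measurable_fun setT f.
  apply: measurable_funM.
    apply: measurable_funM => //; apply: measurableT_comp => //.
    by apply: measurableT_comp => //; exact: measurable_funM.
  apply: measurableT_comp; first exact: measurable_bessel_I0.
  by do 2 apply: measurable_funM => //.
rewrite /hotspot_measure (setIidl Dpolar) integral_mkcond.
rewrite fubini_tonelli1; last 2 first.
- apply/(measurable_restrictT _ mD)/measurable_funTS/measurable_EFinP.
  exact: measurable_hotspot_density.
- move=> p; apply: erestrict_ge0 => q /Dpolar Dq.
  by rewrite lee_fin hotspot_density_ge0.
(* The inner integral vanishes for r outside [i]; inside, it is the angular integral already
   computed. *)
transitivity (\int[leb]_(r in [set` i]) (c%:E * (f r)%:E))%E.
  rewrite [RHS]integral_mkcond; apply: eq_integral => r _.
  rewrite /fubini_F patchE; case: ifPn => [ri|ri].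
    rewrite -EFinM -(@integral_hotspot_density _ _ s)//; last first.
      by move: ri; rewrite inE/= in_itv/= => /andP[].
    rewrite [RHS]integral_mkcond; apply: eq_integral => t _.
    by rewrite !patchE in_setX/= ri.
  apply: integral0_eq => t _.
  by rewrite patchE in_setX/= (negbTE ri).
(* The endpoint [L] is a null set. *)
have -> : (\int[leb]_(r in [set` i]) (c%:E * (f r)%:E) =
    \int[leb]_(r in `[0%R, L]) (c%:E * (f r)%:E))%E.
  rewrite /i; case: b {i D mD Dpolar} => //.
  rewrite integral_itv_bndo_bndc//; apply: measurable_funTS.
  by apply: measurable_funeM; exact/measurable_EFinP.
rewrite ge0_integralZl_EFin//=.
- by move=> r /=; rewrite in_itv/= => /andP[r0 _];
    rewrite lee_fin !mulr_ge0 ?expR_ge0 ?bessel_I0_ge0.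
- by apply: measurable_funTS; exact/measurable_EFinP.
- by rewrite divr_ge0 ?expR_ge0 ?sqr_ge0.
Qed.

End coverage.

Theorem proposition1 (R : realType)
  (delta Rc b P PN alpha K1 K2 W eta0 A Rh thetah l : R)
  (delta_gt0 : 0 < delta) (Rc_gt0 : 0 < Rc) (Rc_lt : Rc < delta)
  (b_gt1 : 1 < b) (P_gt0 : 0 < P) (PN_ge0 : 0 <= PN)
  (alpha_gt0 : 0 < alpha) (alpha_le1 : alpha <= 1)
  (K1_gt0 : 0 < K1) (K2_gt0 : 0 < K2) (W_gt0 : 0 < W) (eta0_gt0 : 0 < eta0)
  (A_gt0 : 0 < A) (Rh_ge0 : 0 <= Rh) (Rh_lt : Rh < Rc)
  (thetah_ge0 : 0 <= thetah) (thetah_lt : thetah < 2 * pi)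
  (l_gt0 : 0 < l) (l_le : l <= eta0) :
  let g := gfactor delta b P PN alpha in
  let eta := throughput K1 K2 W eta0 g in
  let dt := hotspot_measure A Rh thetah in
  let S : \bar R := (\int[dt]_(p in polar_disk Rc) 1)%E in
  let Lambda := min_ginv g Rc (psi K1 K2 W l) in
  (S^-1 * \int[dt]_(p in polar_disk Rc)
            (\1_[set p' | (l%:E <= eta p')%E] p)%:E =
   S^-1 * (expR (- (Rh ^+ 2 / (2 * A ^+ 2))) / A ^+ 2)%:E *
     \int[lebesgue_measure]_(r in `[0%R, Lambda])
       (r * expR (- (r ^+ 2 / (2 * A ^+ 2))) * bessel_I0 (r * Rh / A ^+ 2))%:E)%E.
Proof.
move=> g eta dt S Lambda; rewrite -muleA; congr (_ * _)%E.
have gnd : {in `[0, Rc] &, nondecreasing g} by exact: gfactor_nondecreasing.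
have g0 : g 0 = 0.
  have b0 : 2 * b != 0 by rewrite gt_eqF// mulr_gt0// (lt_trans ltr01).
  by rewrite /g /gfactor mul0r powR0// !mulr0 mul0r addr0.
have psi_ge0 : 0 <= psi K1 K2 W l.
  rewrite mulr_ge0 ?(ltW K2_gt0)// invr_ge0 subr_ge0 -expR0 ler_expR.
  by rewrite divr_ge0 ?mulr_ge0 ?ltW.
have [c sub] : exists c, [set r | 0 <= r <= Rc /\ g r <= psi K1 K2 W l] =
    [set` Interval (BLeft 0) (BSide c Lambda)].
  by apply: sublevel_min_ginv; rewrite ?g0 ?(ltW Rc_gt0).
(* The radial integral is recognised as the hotspot measure of the sector [E] below. *)
rewrite -(@hotspot_measure_sector _ _ _ thetah _ c) ?gt_eqF//.
set E := _ `*` _.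
have mE : measurable E by apply: measurableX; exact: measurable_itv.
have mdisk : measurable (polar_disk Rc).
  by apply: measurableX; exact: measurable_itv.
have Edisk : E `<=` polar_disk Rc.
  by move=> p []; rewrite -sub => -[p1 _] p2; split.
(* Since [E] lies in the disk, its measure is the integral of its indicator there, and the two
   indicators can be compared pointwise. *)
rewrite -[X in _ = hotspot_measure _ _ _ X](setIidl Edisk) -integral_indic//.
apply: eq_integral => p; rewrite inE => -[/= p1 p2]; congr EFin.
rewrite !indicE; congr (_%:R); congr nat_of_bool.
have g_ge0 : 0 <= g p.1.
  move: (p1); rewrite in_itv/= => /andP[p10 _].
  by rewrite -[leLHS]g0; apply: gnd => //; rewrite in_itv/= lexx ltW.
have {}sub : (p.1 \in Interval (BLeft 0) (BSide c Lambda)) <->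
    0 <= p.1 <= Rc /\ g p.1 <= psi K1 K2 W l.
  by have /seteqP[s1 s2] := sub; split; [exact: s2|exact: s1].
apply/idP/idP; rewrite !inE/= throughput_ge//.
  by move=> gp; split => //=; apply/sub.
by move=> [/sub[]].
Qed.
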